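(* Let $\mathcal{G}_1$ and $\mathcal{G}_2$ be two graphs with associated matrices $\mathcal{T}_1$ and $\mathcal{T}_2$, respectively (each $\mathcal{T}_i$ being one of the graph matrices described in the context). Then the following identity of formal power series in $z$ holds: $$\prod_{k \geq 1} \left[ \frac{1}{\det(I-z^{k}\mathcal{T}_{1})} \right]^{\mathcal{C}(k,\mathcal{T}_{2})} =\prod_{j \geq 1} \left[\frac{1}{\det(I-z^{j}\mathcal{T}_{2})} \right]^{\mathcal{C}(j,\mathcal{T}_{1})}.$$
   Context: Graph matrices. The matrix $\mathcal{T}$ associated with a graph $G$ stands for any one of $T$, $A_d$, $T_d$ defined as follows. Graphs may have multiple edges and loops. (i) $G=(V,E)$ a finite connected undirected graph with no 1-degree vertices. Orient the edges $e_1,\dots,e_{|E|}$ arbitrarily and add the oppositely oriented edges $e_{|E|+i}=(e_i)^{-1}$, $1\le i\le |E|$ (for a loop $e_i$, $e_{|E|+i}$ is an additional oriented loop at the same vertex). The edge adjacency matrix $T$ is the $2|E|\times 2|E|$ matrix with $T_{ij}=1$ if the end vertex of $e_i$ is the start vertex of $e_j$ and $e_j$ is not the inverse edge of $e_i$, and $T_{ij}=0$ otherwise. (ii) $G=(V,E)$ a finite, strongly connected directed graph with no 1-degree vertices. The directed vertex adjacency matrix $A_d$ is the $|V|\times|V|$ matrix whose $(i,j)$ entry is the number of edges directed from vertex $i$ to vertex $j$. The directed edge adjacency matrix $T_d$ is the $|E|\times|E|$ matrix with $(T_d)_{ij}=1$ if the end vertex of edge $i$ is the start vertex of edge $j$,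 and $0$ otherwise. For a positive integer $N$, $$\mathcal{C}(N,\mathcal{T})=\frac1N\sum_{g\mid N}\mu(g)\,\mathrm{Tr}\,\mathcal{T}^{N/g},$$ where $g$ ranges over the positive divisors of $N$ and $\mu$ is the Möbius function. (This is the number of equivalence classes, under circular permutation, of nonperiodic cycles of length $N$ in $G$, so it is a nonnegative integer.) *)

(* Defs.v *)
From HB Require Import structures.
From mathcomp Require Import all_boot all_order all_algebra.
From mathcomp Require Import boolp.

Set Implicit Arguments.
Unset Strict Implicit.
Unset Printing Implicit Defensive.

Import GRing.Theory.

Local Open Scope ring_scope.

(* Formal power series [f = \sum_n (coefs f n) z^n] over a field, with the
   Cauchy product.  The units are the series with nonzero constant term, so
   that [f^-1] is the genuine reciprocal series for those. *)
Record fps (F : fieldType) := Fps { coefs : nat -> F }.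

Section FormalPowerSeries.
Variable F : fieldType.
Implicit Types f g h : fps F.

HB.instance Definition _ := gen_eqMixin (fps F).
HB.instance Definition _ := gen_choiceMixin (fps F).

Lemma fpsP f g : coefs f =1 coefs g <-> f = g.
Proof.
split=> [|->] //; case: f g => [f] [g] /= fg; congr Fps.
exact/funext.
Qed.

Definition fps_zero : fps F := Fps (fun=> 0).
Definition fps_opp f : fps F := Fps (fun n => - coefs f n).
Definition fps_add f g : fps F := Fps (fun n => coefs f n + coefs g n).

Fact fps_addA : associative fps_add.
Proof. by move=> f g h; apply/fpsP => n /=; rewrite addrA. Qed.
Fact fps_addC : commutative fps_add.
Proof. by move=> f g; apply/fpsP => n /=; rewrite addrC. Qed.
Fact fps_add0 : left_id fps_zero fps_add.
Proof. by move=> f; apply/fpsP => n /=; rewrite add0r. Qed.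
Fact fps_addN : left_inverse fps_zero fps_opp fps_add.
Proof. by move=> f; apply/fpsP => n /=; rewrite addNr. Qed.

HB.instance Definition _ :=
  GRing.isZmodule.Build (fps F) fps_addA fps_addC fps_add0 fps_addN.

Definition fpsC (c : F) : fps F := Fps (fun n => if n == 0%N then c else 0).
Definition fpsX : fps F := Fps (fun n => (n == 1%N)%:R).

Definition fps_mul f g : fps F :=
  Fps (fun n => \sum_(i < n.+1) coefs f i * coefs g (n - i)%N).

Definition fps_trunc n f : {poly F} := \poly_(i < n) coefs f i.

Fact coefs_mul_trunc n f g m : (m < n)%N ->
  coefs (fps_mul f g) m = (fps_trunc n f * fps_trunc n g)`_m.
Proof.
move=> mn; rewrite coefM /=; apply: eq_bigr => i _.
have im : (i <= m)%N by rewrite -ltnS.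
by rewrite !coef_poly (leq_ltn_trans im mn) (leq_ltn_trans (leq_subr i m) mn).
Qed.

Fact fps_mulC : commutative fps_mul.
Proof.
by move=> f g; apply/fpsP => n; rewrite !(@coefs_mul_trunc n.+1) // mulrC.
Qed.

Fact fps_mulA : associative fps_mul.
Proof.
move=> f g h; apply/fpsP => n.
have tr k a : (k < n.+1)%N -> coefs a k = (fps_trunc n.+1 a)`_k.
  by move=> kn; rewrite coef_poly kn.
transitivity
  (fps_trunc n.+1 f * (fps_trunc n.+1 g * fps_trunc n.+1 h))`_n.
  rewrite coefM; apply: eq_bigr => i _.
  by rewrite (tr i f) // (@coefs_mul_trunc n.+1) // ltnS leq_subr.
rewrite mulrA coefM; apply: eq_bigr => i _.
by rewrite (@coefs_mul_trunc n.+1) // -tr // ltnS leq_subr.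
Qed.

Fact fps_mul1 : left_id (fpsC 1) fps_mul.
Proof.
move=> f; apply/fpsP => n /=; rewrite big_ord_recl /= mul1r subn0.
by rewrite big1 ?addr0 // => i _; rewrite mul0r.
Qed.

Fact fps_mulDl : left_distributive fps_mul +%R.
Proof.
move=> f g h; apply/fpsP => n /=; rewrite -big_split /=.
by apply: eq_bigr => i _; rewrite mulrDl.
Qed.

Fact fps_1neq0 : fpsC 1 != 0.
Proof.
apply/eqP => /(congr1 (fun f => coefs f 0)) /= /eqP.
by rewrite oner_eq0.
Qed.

HB.instance Definition _ :=
  GRing.Zmodule_isComNzRing.Build (fps F)
    fps_mulA fps_mulC fps_mul1 fps_mulDl fps_1neq0.

(* The first [n] coefficients of the reciprocal of [f], from
   [\sum_(i <= n) f_(n - i) g_i = 0] for [0 < n]. *)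
Fixpoint fps_inv_seq f (n : nat) : seq F :=
  if n is m.+1 then
    let s := fps_inv_seq f m in
    rcons s ((coefs f 0)^-1 *
             ((m == 0%N)%:R - \sum_(i < m) s`_i * coefs f (m - i)%N))
  else [::].

Definition fps_unit : {pred fps F} := fun f => coefs f 0 != 0.
Definition fps_inv f : fps F :=
  if fps_unit f then Fps (fun n => (fps_inv_seq f n.+1)`_n) else f.

Fact size_fps_inv_seq f n : size (fps_inv_seq f n) = n.
Proof. by elim: n => //= n IH; rewrite size_rcons IH. Qed.

Fact nth_fps_inv_seq f n i : (i < n)%N ->
  (fps_inv_seq f n)`_i = (fps_inv_seq f i.+1)`_i.
Proof.
elim: n => // n IH; rewrite ltnS leq_eqVlt => /predU1P[-> //|lt_in].
by rewrite [LHS]/= nth_rcons size_fps_inv_seq lt_in IH.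
Qed.

Fact fps_mulV : {in fps_unit, left_inverse 1 fps_inv *%R}.
Proof.
move=> f uf; have f0 : coefs f 0 != 0 by exact: uf.
rewrite /fps_inv (_ : fps_unit f = true) //; apply/fpsP => n.
rewrite [LHS]/= big_ord_recr [fps_inv_seq _ _]lock /= -lock.
rewrite subnn [X in _ + X]mulrC.
rewrite [X in _ + _ * X](_ : _ = (coefs f 0)^-1 * ((n == 0%N)%:R -
   \sum_(i < n) (fps_inv_seq f i.+1)`_i * coefs f (n - i)%N)); last first.
  rewrite /= nth_rcons size_fps_inv_seq ltnn eqxx; congr (_ * (_ - _)).
  by apply: eq_bigr => i _; rewrite nth_fps_inv_seq.
by rewrite mulrA divff // mul1r addrC subrK; case: (n == 0%N).
Qed.

Fact fps_unitPl f g : g * f = 1 -> fps_unit f.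
Proof.
move=> /(congr1 (fun f => coefs f 0)) /=; rewrite big_ord1 /= => gf1.
by apply/eqP => f0; move/eqP: gf1; rewrite subnn f0 mulr0 eq_sym oner_eq0.
Qed.

Fact fps_inv_out : {in [predC fps_unit], fps_inv =1 id}.
Proof.
by move=> f; rewrite inE /fps_inv => /negbTE uf; rewrite (_ : fps_unit f = false).
Qed.

HB.instance Definition _ :=
  GRing.ComNzRing_hasMulInverse.Build (fps F) fps_mulV fps_unitPl fps_inv_out.

(* [P = \prod_(k >= 1) f k], for the usual notion of convergence of formal
   power series: every coefficient of the partial products is eventually
   constant, equal to that of [P].  Such a [P] is unique. *)
Definition is_infinite_product (f : nat -> fps F) (P : fps F) : Prop :=
  forall m : nat, exists K : nat, forall n : nat, (K <= n)%N ->
    coefs (\prod_(1 <= k < n.+1) f k) m = coefs P m.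

End FormalPowerSeries.

(* Undirected multigraphs with loops: an edge is a loop exactly when its set
   of end vertices is a singleton. *)
Record multigraph := Multigraph {
  mg_vert : finType;
  mg_edge : finType;
  mg_ends : mg_edge -> {set mg_vert};
  mg_endsP : forall e, (0 < #|mg_ends e| <= 2)%N }.

Definition mg_adj (G : multigraph) : rel (mg_vert G) :=
  fun x y => [exists e : mg_edge G, (x \in mg_ends e) && (y \in mg_ends e)].

Definition mg_connected (G : multigraph) : Prop :=
  forall x y : mg_vert G, connect (@mg_adj G) x y.

(* A loop contributes 2 to the degree of its vertex. *)
Definition mg_degree (G : multigraph) (v : mg_vert G) : nat :=
  (\sum_(e : mg_edge G | v \in mg_ends e)
     (if #|mg_ends e| == 1 then 2 else 1))%N.

Record orientation (G : multigraph) := Orientation {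
  o_tail : mg_edge G -> mg_vert G;
  o_head : mg_edge G -> mg_vert G;
  o_ends : forall e, mg_ends e = [set o_tail e; o_head e] }.

(* [inl e] is the edge [e] with its chosen orientation, [inr e] is the inverse
   of [inl e]; in the enumeration of this type the inverses come last. *)
Definition oedge (G : multigraph) : finType := (mg_edge G + mg_edge G)%type.

Definition oedge_inv (G : multigraph) (a : oedge G) : oedge G :=
  match a with inl e => inr e | inr e => inl e end.

Definition oedge_start (G : multigraph) (o : orientation G) (a : oedge G) :=
  match a with inl e => o_tail o e | inr e => o_head o e end.

Definition oedge_end (G : multigraph) (o : orientation G) (a : oedge G) :=
  oedge_start o (oedge_inv a).

Definition edge_adjacency (G : multigraph) (o : orientation G) :
    'M[rat]_#|oedge G| :=
  \matrix_(i, j)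
    ((oedge_end o (enum_val i) == oedge_start o (enum_val j)) &&
     (enum_val j != oedge_inv (enum_val i)))%:R.

Record multidigraph := Multidigraph {
  md_vert : finType;
  md_edge : finType;
  md_start : md_edge -> md_vert;
  md_end : md_edge -> md_vert }.

Definition md_adj (D : multidigraph) : rel (md_vert D) :=
  fun x y => [exists e : md_edge D, (md_start e == x) && (md_end e == y)].

Definition md_strongly_connected (D : multidigraph) : Prop :=
  forall x y : md_vert D, connect (@md_adj D) x y.

(* Total degree, so that again a loop contributes 2. *)
Definition md_degree (D : multidigraph) (v : md_vert D) : nat :=
  (#|[set e : md_edge D | md_start e == v]| +
   #|[set e : md_edge D | md_end e == v]|)%N.

Definition directed_vertex_adjacency (D : multidigraph) :
    'M[rat]_#|md_vert D| :=
  \matrix_(i, j)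
    #|[set e : md_edge D | (md_start e == enum_val i) &&
                           (md_end e == enum_val j)]|%:R.

Definition directed_edge_adjacency (D : multidigraph) :
    'M[rat]_#|md_edge D| :=
  \matrix_(i, j) (md_end (enum_val i) == md_start (enum_val j))%:R.

Variant is_graph_matrix : forall n : nat, 'M[rat]_n -> Prop :=
  | GraphEdge (G : multigraph) (o : orientation G) of
      mg_connected G & (forall v : mg_vert G, mg_degree v != 1%N) :
      is_graph_matrix (edge_adjacency o)
  | DigraphVertex (D : multidigraph) of
      md_strongly_connected D & (forall v : md_vert D, md_degree v != 1%N) :
      is_graph_matrix (directed_vertex_adjacency D)
  | DigraphEdge (D : multidigraph) of
      md_strongly_connected D & (forall v : md_vert D, md_degree v != 1%N) :
      is_graph_matrix (directed_edge_adjacency D).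

Definition moebius (n : nat) : int :=
  if all (fun p => logn p n == 1%N) (primes n) then (-1) ^+ size (primes n)
  else 0.

Definition cycle_count (n : nat) (T : 'M[rat]_n) (N : nat) : rat :=
  N%:R^-1 * \sum_(g <- divisors N) (moebius g)%:~R * \tr (T ^+ (N %/ g)).

Definition det_series (n : nat) (T : 'M[rat]_n) (k : nat) : fps rat :=
  \det (1%:M - fpsX rat ^+ k *: map_mx (@fpsC rat) T).

(* For graph matrices [cycle_count T2 k] counts classes of cycles and is a
   natural number when [0 < k], so that [Num.truncn] only changes its type. *)
Definition product_factor (n1 n2 : nat) (T1 : 'M[rat]_n1) (T2 : 'M[rat]_n2)
    (k : nat) : fps rat :=
  (1 / det_series T1 k) ^+ Num.truncn (cycle_count T2 k).

(* Main.v *)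
From HB Require Import structures.
Require Import Defs.
From mathcomp Require Import all_boot all_order all_algebra perm.

(** Write [t_i m] for the trace of [T_i ^+ m] and [*] for Dirichlet
convolution of arithmetic functions, so that [k C(k, T) = (mu * t) k].

Take logarithms.  Since [- log det (1 - z^k T) = \sum_(m > 0) t m z^(k m) / m],
the coefficient of [z^m] in the logarithm of the first product is
[1 / m] times the sum over the divisors [k] of [m] of
[k C(k, T_2) t_1 (m / k)], that is, [(mu * t_2 * t_1) m / m].  As Dirichlet
convolution is commutative and associative ([dconvC], [dconvCA]) this is
symmetric in the two matrices, hence the identity.

Logarithms are handled through the Euler operator [z d/dz]: [is_logder f L]
says that [f] has constant term 1 and that [L] is [z f' / f].  Logarithmic
derivatives turn products into sums ([logder_prod]), and in characteristic
zero the coefficients of [L] up to a given degree determine those of [f]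
([eq_coefs_logder]).  The latter gives both the convergence of each
infinite product and the equality of the two.  The logarithmic derivative of
[det (1 - z^k T)] ([det_series_logder]) comes from Jacobi's formula
([derivation_det]), valid for any derivation of a commutative ring, together
with the expansion of [(1 - z^k T)^-1] as a geometric series.

The exponents are truncations to natural numbers of the rational numbers
[C(k, T)], so the argument also has to show that these are natural numbers
([cycle_count_nat]).  The trace of the [m]-th power of a 0/1 matrix counts
the closed walks of length [m] ([trace_expr_adjacency]), a vertex adjacency
matrix has the same traces as the corresponding edge adjacency matrix
([mxtrace_expr_vertex_edge]), and a Moebius sum of numbers of fixed points of
the iterates of a bijection counts the points whose orbit has exactly [N]
elements, a multiple of [N] ([moebius_sum_fixpoints]). *)

Set Implicit Arguments.
Unset Strict Implicit.
Unset Printing Implicit Defensive.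

Import GRing.Theory Num.Theory.

Local Open Scope ring_scope.

(** * Dirichlet convolution and Moebius inversion *)

Section Dirichlet.
Variable R : comNzRingType.
Implicit Types f g h : nat -> R.

Definition dconv f g n : R := \sum_(d <- divisors n) f d * g (n %/ d)%N.

Lemma eq_dconv_r f g h n : (0 < n)%N ->
  (forall m, (0 < m)%N -> g m = h m) -> dconv f g n = dconv f h n.
Proof.
move=> n0 gh; apply: eq_big_seq => d; rewrite -dvdn_divisors // => dn.
rewrite gh //; have d0 := dvdn_gt0 n0 dn.
by rewrite divn_gt0 // dvdn_leq.
Qed.

Lemma dconvC f g n : (0 < n)%N -> dconv f g n = dconv g f n.
Proof.
move=> n0; have codiv d : d \in divisors n -> (n %/ (n %/ d))%N = d.
  rewrite -dvdn_divisors // => dn.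
  by rewrite divnA // mulKn.
have ndiv d : d \in divisors n -> (n %/ d)%N \in divisors n.
  by rewrite -!dvdn_divisors // => dn; rewrite dvdn_div.
have P : perm_eq (divisors n) [seq (n %/ d)%N | d <- divisors n].
  apply: uniq_perm; first exact: divisors_uniq.
    rewrite map_inj_in_uniq ?divisors_uniq // => a b /codiv {2}<- /codiv {2}<-.
    by move=> ->.
  move=> d; apply/idP/mapP => [dn|[c cn ->]]; last exact: ndiv.
  by exists (n %/ d)%N; rewrite ?ndiv ?codiv.
rewrite /dconv (perm_big _ P) big_map /=.
by apply: eq_big_seq => d dn; rewrite codiv // mulrC.
Qed.

Lemma big_divisors_codivisor (F : nat -> R) a n : (0 < n)%N -> (a %| n)%N ->
  \sum_(b <- divisors (n %/ a)) F b =
  \sum_(b <- divisors n | (a * b %| n)%N) F b.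
Proof.
move=> n0 an; have a0 := dvdn_gt0 n0 an.
have na0 : (0 < n %/ a)%N by rewrite divn_gt0 // dvdn_leq.
rewrite -[RHS]big_filter; apply: perm_big; apply: uniq_perm.
- exact: divisors_uniq.
- exact/filter_uniq/divisors_uniq.
move=> b; rewrite mem_filter -!dvdn_divisors // dvdn_divRL // mulnC.
by case: (boolP (_ * _ %| _)%N) => //= /(dvdn_trans (dvdn_mull _ (dvdnn _))) ->.
Qed.

(** Both sides sum over the pairs [(a, b)] such that [a * b] divides [n]. *)
Lemma dconvCA f g h n : (0 < n)%N ->
  dconv f (dconv g h) n = dconv g (dconv f h) n.
Proof.
move=> n0; have expand f1 f2 : dconv f1 (dconv f2 h) n =
    \sum_(a <- divisors n) \sum_(b <- divisors n | (a * b %| n)%N)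
      f1 a * f2 b * h (n %/ (a * b))%N.
  apply: eq_big_seq => a; rewrite -dvdn_divisors // => an.
  rewrite -(big_divisors_codivisor
    (fun b => f1 a * f2 b * h (n %/ (a * b))%N)) //.
  by rewrite mulr_sumr; apply: eq_bigr => b _; rewrite -divnMA mulrA.
rewrite !expand (exchange_big_dep xpredT) //=; apply: eq_bigr => b _.
by apply: eq_big => a; rewrite mulnC // => _; rewrite [f a * _]mulrC.
Qed.

End Dirichlet.

Lemma moebius_primeM p m : prime p -> (0 < m)%N -> ~~ (p %| m)%N ->
  moebius (p * m) = - moebius m.
Proof.
move=> pp m0 npm; have p0 := prime_gt0 pp.
have lp : logn p m = 0%N.
  by apply/eqP; rewrite -leqn0 leqNgt logn_gt0 mem_primes pp m0.
have P : perm_eq (primes (p * m)) (p :: primes m).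
  apply: uniq_perm; rewrite ?primes_uniq //= ?primes_uniq ?mem_primes ?pp ?m0 ?npm //.
  by move=> q; rewrite primesM // (primes_prime pp) !inE.
rewrite /moebius (perm_all _ P) (perm_size P) /= lognM // logn_prime // eqxx lp /=.
rewrite (@eq_in_all _ _ (fun q => logn q m == 1%N)).
  by case: all; rewrite ?oppr0 // exprS mulN1r.
move=> q; rewrite mem_primes => /and3P[pq _ qm]; rewrite lognM // logn_prime //.
by case: (q =P p) => // pq'; rewrite -pq' qm in npm.
Qed.

Lemma moebius_sqr_dvd p n : prime p -> (0 < n)%N -> (p ^ 2 %| n)%N ->
  moebius n = 0.
Proof.
move=> pp n0 pn; rewrite /moebius.
have l2 : (1 < logn p n)%N by rewrite -pfactor_dvdn.
case: allP => // /(_ p); rewrite -logn_gt0 (ltnW l2) => /(_ isT) /eqP l1.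
by rewrite l1 in l2.
Qed.

(** Let [p] be the least prime divisor of [n].  Divisors prime to [p] pair off,
with opposite values, with their multiples by [p]; the divisors in neither
class are divisible by [p ^ 2], and [moebius] vanishes there. *)
Lemma sum_moebius n : (0 < n)%N ->
  \sum_(d <- divisors n) moebius d = (n == 1%N)%:R.
Proof.
move=> n0; have [->|n1] := eqVneq n 1%N; first by rewrite big_seq1.
have {}n1 : (1 < n)%N by rewrite ltn_neqAle eq_sym n1.
set p := pdiv n; have pp : prime p := pdiv_prime n1.
have p0 := prime_gt0 pp.
have pn : (p %| n)%N := pdiv_dvd n.
have np0 : (0 < n %/ p)%N by rewrite divn_gt0 // dvdn_leq.
rewrite (bigID (fun d => p %| d)%N) /=.
rewrite -big_filter (perm_big [seq (p * d)%N | d <- divisors (n %/ p)]);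
  last first.
  apply: uniq_perm; first exact/filter_uniq/divisors_uniq.
    rewrite map_inj_uniq ?divisors_uniq // => a b /eqP.
    by rewrite eqn_pmul2l // => /eqP.
  move=> d; rewrite mem_filter -dvdn_divisors //.
  apply/andP/mapP => [[/dvdnP[c ->] dn]|[c]].
    by exists c; rewrite ?[(p * _)%N]mulnC // -dvdn_divisors // dvdn_divRL.
  by rewrite -dvdn_divisors // dvdn_divRL // mulnC => cn ->; rewrite dvdn_mulr.
rewrite big_map (bigID (fun d => p %| d)%N) /= big1_seq ?add0r; last first.
  move=> d /andP[pd]; rewrite -dvdn_divisors // => dn.
  by rewrite (@moebius_sqr_dvd p) // ?muln_gt0 ?p0 ?(dvdn_gt0 np0) // dvdn_pmul2l.
rewrite big_seq_cond (eq_bigr (fun d => - moebius d)); last first.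
  move=> d /andP[]; rewrite -dvdn_divisors // => dn pd.
  by rewrite moebius_primeM // (dvdn_gt0 np0).
rewrite -big_seq_cond sumrN -[X in - X]big_filter -[X in _ + X]big_filter.
rewrite (perm_big [seq d <- divisors n | ~~ (p %| d)%N]) ?addNr //.
apply: uniq_perm; rewrite ?filter_uniq ?divisors_uniq // => d.
rewrite !mem_filter -!dvdn_divisors //; case: (boolP (p %| d)%N) => //= npd.
by rewrite -{2}(divnK pn) Gauss_dvdl // coprime_sym prime_coprime.
Qed.

(** [g = f * 1] for Dirichlet convolution, and [mu * 1] is the unit. *)
Lemma moebius_inversion (R : comNzRingType) (f g : nat -> R) n : (0 < n)%N ->
  (forall m, (0 < m)%N -> g m = \sum_(d <- divisors m) f d) ->
  dconv (fun d => (moebius d)%:~R) g n = f n.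
Proof.
move=> n0 gE.
pose mu d : R := (moebius d)%:~R.
have g_conv m : (0 < m)%N -> g m = dconv f (fun=> 1) m.
  by move=> /gE ->; apply: eq_bigr => d _; rewrite mulr1.
have mu_conv m : (0 < m)%N -> dconv mu (fun=> 1) m = (m == 1%N)%:R.
  move=> m0; rewrite /dconv; under eq_bigr do rewrite mulr1.
  by rewrite -rmorph_sum /= sum_moebius //; case: (m == 1%N).
rewrite (eq_dconv_r _ n0 g_conv) dconvCA // (eq_dconv_r _ n0 mu_conv) dconvC //.
rewrite /dconv (bigD1_seq 1%N) ?divisors_uniq -?dvdn_divisors ?dvd1n //=.
by rewrite mul1r divn1 big1 ?addr0 // => d /negbTE ->; rewrite mul0r.
Qed.

(** * Fixed points of the iterates of a bijection *)

Section OrbitsOfLengthN.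
Variables (X : finType) (f : X -> X) (inj_f : injective f).
Variable a : {pred X}.
Hypothesis fa : fclosed f a.

Lemma iter_eq_order x n : (iter n f x == x) = (order f x %| n)%N.
Proof.
have mo k : iter (k * order f x) f x = x.
  by elim: k => // k IH; rewrite mulSn iterD IH iter_order.
rewrite /dvdn {1}(divn_eq n (order f x)) addnC iterD mo.
have lt : (n %% order f x < order f x)%N by rewrite ltn_mod order_gt0.
apply/eqP/eqP => [E|-> //].
by rewrite -(findex_iter lt) E findex0.
Qed.

(** A point is fixed by [iter m f] exactly when its order divides [m], so
Moebius inversion isolates the points of order exactly [n], and these split into
orbits of [n] points. *)
Lemma moebius_sum_fixpoints (n : nat) : (0 < n)%N ->
  dconv (fun d => (moebius d)%:~R)
    (fun d => #|[pred x in a | iter d f x == x]|%:R) n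
  = (fcard f [pred x in a | order f x == n])%:R * n%:R :> rat.
Proof.
move=> n0; rewrite (moebius_inversion
  (f := fun d => #|[pred x in a | order f x == d]|%:R)) //.
  rewrite -natrM (fcard_order_set inj_f) //.
    by apply/subsetP => x; rewrite !inE => /andP[].
  move=> x y /eqP <-; rewrite !inE -(fclosed1 fa).
  by rewrite [order f x](eq_card (same_fconnect1 inj_f x)).
move=> m m0; rewrite -natr_sum; congr _%:R.
have card_sum (P : pred X) :
    #|[pred x in a | P x]| = (\sum_(x in a) P x)%N.
  by rewrite -sum1_card big_mkcondr; apply: eq_bigr => x _; case: (P x).
rewrite card_sum; under [RHS]eq_bigr do rewrite card_sum.
rewrite exchange_big; apply: eq_bigr => x _.
rewrite iter_eq_order dvdn_divisors // -count_uniq_mem ?divisors_uniq //.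
rewrite -sum1_count big_mkcond; apply: eq_bigr => d _.
by rewrite /= eq_sym; case: eqP.
Qed.
End OrbitsOfLengthN.

(** * Closed walks and the rotation of cyclic words *)

Lemma cycle_flatten_nseq (X : Type) (e : rel X) q (s : seq X) : (0 < q)%N ->
  cycle e (flatten (nseq q s)) = cycle e s.
Proof.
case: s => [|x s]; first by elim: q => // q IH _ /=; case: q IH => // q ->.
case: q => // q _; set t := flatten _.
have lastE x0 : last x0 t = last x s.
  rewrite /t; elim: q {t} x0 => [|q IH] x0 /=; first by rewrite cats0.
  by rewrite last_cat; apply: IH.
rewrite !(cycle_path x) lastE -[last x (x :: s)]/(last x s) {lastE}/t.
elim: q => [|q IH]; first by rewrite /= cats0.
rewrite [flatten _]/= -cat_cons cat_path [last _ _]/=.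
by rewrite [X in _ && X]IH andbb.
Qed.

(** Words that commute are powers of a common word; here the length of one is a
multiple of the length of the other. *)
Lemma cat_comm_nseq (X : eqType) (s u : seq X) q :
  size u = (q * size s)%N -> u ++ s = s ++ u -> u = flatten (nseq q s).
Proof.
elim: q u => [|q IH] u; first by move=> /size0nil ->.
rewrite mulSn => su us.
have uE : u = s ++ drop (size s) u.
  have le : (size s <= size u)%N by rewrite su leq_addr.
  rewrite -{1}(cat_take_drop (size s) u); congr (_ ++ _).
  by rewrite -(takel_cat s le) us take_size_cat.
rewrite uE /=; congr (_ ++ _); apply: IH; first by rewrite size_drop su addKn.
by move: us; rewrite {1 2}uE -catA => /eqP; rewrite eqseq_cat // eqxx /= => /eqP.
Qed.

Lemma rot_flatten_nseq (X : Type) (s : seq X) q :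
  rot (size s) (flatten (nseq q s)) = flatten (nseq q s).
Proof.
case: q => [|q]; first by rewrite /rot /=; case: (size s).
rewrite [flatten _]/= rot_size_cat.
by elim: q => [|q IH] /=; rewrite ?cats0 // -catA IH.
Qed.

Lemma rot_eq_nseq (X : eqType) (t : seq X) d q : (0 < q)%N ->
  size t = (q * d)%N -> rot d t = t -> t = flatten (nseq q (take d t)).
Proof.
case: q => // q _; rewrite mulSn => st; rewrite /rot => rt.
have sz : size (take d t) = d by rewrite size_takel // st leq_addr.
rewrite -{1}(cat_take_drop d t) /=; congr (_ ++ _); apply: cat_comm_nseq.
  by rewrite size_drop st sz addKn.
by rewrite rt cat_take_drop.
Qed.

Section ClosedWalks.
Variables (X : finType) (e : rel X).

Definition closed_walks n := #|[pred t : n.-tuple X | cycle e t]|.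

Definition rot1 n (t : n.-tuple X) : n.-tuple X := [tuple of rot 1 t].

Lemma rot1_inj n : injective (@rot1 n).
Proof. by move=> s t /(congr1 val) /= /rot_inj /val_inj. Qed.

Lemma iter_rot1 n d (t : n.-tuple X) : (d <= n)%N ->
  iter d (@rot1 n) t = rot d t :> seq X.
Proof.
elim: d => [|d IH] dn; first by rewrite rot0.
by rewrite iterS /= IH ?(ltnW dn) // -rotS ?size_tuple.
Qed.

(** A closed walk fixed by the rotation by [d] is a closed walk of length [d]
run through [q] times. *)
Lemma card_rot_fixed_walks d q : (0 < q)%N ->
  #|[pred t in [pred t : (q * d).-tuple X | cycle e t] |
     iter d (@rot1 _) t == t]| = closed_walks d.
Proof.
move=> q0.
have sizeP (s : d.-tuple X) : size (flatten (nseq q (val s))) == (q * d)%N.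
  by rewrite size_flatten /shape map_nseq sumn_nseq size_tuple mulnC.
pose blowup (s : d.-tuple X) := Tuple (sizeP s).
have blowup_inj : injective blowup.
  move=> s t /(congr1 val) /=; case: q q0 {sizeP blowup} => // q _ /= /eqP.
  by rewrite eqseq_cat ?size_tuple // => /andP[/eqP /val_inj].
rewrite /closed_walks -(card_image blowup_inj); apply: eq_card => t.
have dn : (d <= q * d)%N by rewrite leq_pmull.
rewrite !inE -val_eqE /= iter_rot1 //.
apply/andP/imageP => [[ct /eqP rt]|[s]]; last first.
  rewrite inE => cs ->; rewrite /= cycle_flatten_nseq //; split=> //.
  by rewrite -{1}(size_tuple s) rot_flatten_nseq.
have tE := rot_eq_nseq q0 (size_tuple t) rt.
have sz : size (take d t) == d by rewrite size_takel ?size_tuple.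
exists (Tuple sz); last exact/val_inj.
by rewrite inE /= -(@cycle_flatten_nseq _ _ q) // -tE.
Qed.

Lemma moebius_closed_walks n : (0 < n)%N ->
  exists c : nat,
    dconv (fun d => (moebius d)%:~R) (fun d => (closed_walks d)%:R) n
    = c%:R * n%:R :> rat.
Proof.
move=> n0; pose a := [pred t : n.-tuple X | cycle e t].
exists (fcard (@rot1 n) [pred t in a | order (@rot1 n) t == n]).
rewrite -moebius_sum_fixpoints //; first last.
- by move=> s t /eqP <-; rewrite !inE /= rot_cycle.
- exact: rot1_inj.
rewrite dconvC // [RHS]dconvC //; apply: eq_big_seq => d.
rewrite -dvdn_divisors // => dn.
congr (_%:R * _); rewrite /a; case/dvdnP: dn n0 {a} => q ->.
by rewrite muln_gt0 => /andP[q0 _]; rewrite card_rot_fixed_walks.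
Qed.

End ClosedWalks.

Section TraceOfPowers.
Variable n : nat.
Variable r : rel 'I_n.
Let A : 'M[rat]_n := \matrix_(i, j) (r i j)%:R.

(** The walk from [x] to [y] is recorded without its first vertex [x]. *)
Lemma expr_adjacency m (x y : 'I_n) :
  (A ^+ m) x y =
  #|[pred t : m.-tuple 'I_n | path r x t & last x t == y]|%:R.
Proof.
elim: m x => [|m IH] x.
  rewrite expr0 [1]/(1%:M) mxE -sum1_card big_mkcond.
  rewrite (big_pred1 [tuple]) /= => [|t]; last exact/esym/eqP/tuple0.
  by rewrite inE /=; case: eqP.
rewrite exprS mxE.
under eq_bigr => z _ do rewrite IH mxE -natrM mulnC.
rewrite -natr_sum; congr _%:R.
rewrite -[RHS]sum1_card.
rewrite (reindex
  (fun p : 'I_n * m.-tuple 'I_n => [tuple of p.1 :: p.2])) /=; last first.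
  exists (fun t => (thead t, [tuple of behead t])) => [[z t] _|t _] /=.
    by congr pair; apply/val_inj.
  by rewrite [RHS]tuple_eta.
transitivity (\sum_z \sum_(t : m.-tuple 'I_n)
    (r x z && path r z t && (last z t == y)))%N.
  apply: eq_bigr => z _; rewrite -sum1_card big_distrl /= big_mkcond.
  apply: eq_bigr => t _; rewrite inE mul1n -andbA.
  by case: (r x z); case: (_ && _).
rewrite pair_bigA [RHS]big_mkcond; apply: eq_bigr => -[z t] _.
by rewrite inE /=; case: (_ && _).
Qed.

(** [cycle r t] says that [t] is a path starting from its own last vertex, which
is the diagonal index contributing [t] to the trace. *)
Lemma trace_expr_adjacency m : (0 < m)%N ->
  \tr (A ^+ m) = (closed_walks r m)%:R.
Proof.
move=> m0; rewrite /mxtrace; under eq_bigr do rewrite expr_adjacency -sum1_card.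
rewrite -natr_sum; congr _%:R; rewrite (exchange_big_dep xpredT) //=.
rewrite /closed_walks -[RHS]sum1_card [RHS]big_mkcond /=; apply: eq_bigr => t _.
case: m m0 t => // m _ t; rewrite inE (cycle_path (thead t)).
set z := last _ t; have zE x : last x t = z.
  by rewrite /z (tuple_eta t).
rewrite big_mkcond (bigD1 z) //= big1 ?addn0 => [|x xz]; rewrite !inE zE.
  by rewrite eqxx andbT.
by rewrite eq_sym (negbTE xz) andbF.
Qed.
End TraceOfPowers.

Lemma cycle_countE n (T : 'M[rat]_n) N :
  cycle_count T N =
  N%:R^-1 * dconv (fun d => (moebius d)%:~R) (fun d => \tr (T ^+ d)) N.
Proof. by []. Qed.

Lemma cycle_count_adjacency_nat n (r : rel 'I_n) N : (0 < N)%N ->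
  cycle_count (\matrix_(i, j) (r i j)%:R) N \is a Num.nat.
Proof.
move=> N0; rewrite cycle_countE (eq_dconv_r _ N0 (trace_expr_adjacency r)).
have [c ->] := moebius_closed_walks r N0.
by rewrite mulrCA mulVf ?mulr1 ?natr_nat // pnatr_eq0 -lt0n.
Qed.

Lemma mxtrace_expr_mulC (R : comNzRingType) m n
    (A : 'M[R]_(m, n)) (B : 'M_(n, m)) k : (0 < k)%N -> \tr ((A *m B) ^+ k) = \tr ((B *m A) ^+ k).
Proof.
case: k => // k _.
have E : (A *m B) ^+ k *m A = A *m (B *m A) ^+ k.
  elim: k => [|k IH]; first by rewrite !expr0 mul1mx mulmx1.
  by rewrite !exprS -!mulmxE -!mulmxA IH.
by rewrite exprSr -mulmxE mulmxA E mxtrace_mulC mulmxA mulmxE -exprS.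
Qed.

(** With [S] and [E] the incidence matrices of start and end vertices, the
vertex adjacency matrix is [S *m E] and the edge adjacency matrix is
[E *m S].  This reduces matrices with arbitrary natural entries to 0/1
matrices. *)
Lemma mxtrace_expr_vertex_edge (D : multidigraph) k : (0 < k)%N ->
  \tr (directed_vertex_adjacency D ^+ k) = \tr (directed_edge_adjacency D ^+ k).
Proof.
move=> k0.
pose S : 'M[rat]_(#|md_vert D|, #|md_edge D|) :=
  \matrix_(i, j) (md_start (enum_val j) == enum_val i)%:R.
pose E : 'M[rat]_(#|md_edge D|, #|md_vert D|) :=
  \matrix_(i, j) (md_end (enum_val i) == enum_val j)%:R.
have -> : directed_vertex_adjacency D = S *m E.
  apply/matrixP => i j; rewrite !mxE.
  rewrite cardsE -sum1_card natr_sum big_mkcond /=.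
  rewrite (reindex_onto enum_val enum_rank) /=; last first.
    by move=> e _; rewrite enum_rankK.
  rewrite (eq_bigl xpredT) => [|e]; last by rewrite enum_valK eqxx.
  by apply: eq_bigr => e _; rewrite !mxE -natrM mulnb unfold_in; case: (_ && _).
have -> : directed_edge_adjacency D = E *m S.
  apply/matrixP => i j; rewrite !mxE (bigD1 (enum_rank (md_end (enum_val i)))) //=.
  rewrite big1 => [|v vi]; first by rewrite addr0 !mxE enum_rankK eqxx mul1r eq_sym.
  rewrite !mxE; case: eqP => [ev|_]; last by rewrite mul0r.
  by rewrite ev enum_valK eqxx in vi.
exact: mxtrace_expr_mulC.
Qed.

Lemma cycle_count_nat n (T : 'M[rat]_n) N :
  is_graph_matrix T -> (0 < N)%N -> cycle_count T N \is a Num.nat.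
Proof.
case=> [G o _ _|D _ _|D _ _] N0.
- exact: cycle_count_adjacency_nat.
- rewrite cycle_countE (eq_dconv_r _ N0 (@mxtrace_expr_vertex_edge D)).
  exact: cycle_count_adjacency_nat.
- exact: cycle_count_adjacency_nat.
Qed.

(** * Derivations and determinants *)

Section Derivation.
Variables (R : comNzRingType) (D : R -> R).
Hypothesis DD : {morph D : x y / x + y}.
Hypothesis DM : forall x y, D (x * y) = D x * y + x * D y.

Let D0 : D 0 = 0. Proof. by apply: (addrI (D 0)); rewrite -DD !addr0. Qed.

Let D1 : D 1 = 0.
Proof. by apply: (addrI (D 1)); rewrite -{3}[1]mulr1 DM !mulr1 mul1r addr0. Qed.

Let DN x : D (- x) = - D x.
Proof. by apply: (addrI (D x)); rewrite -DD !subrr. Qed.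

(** The range is assumed duplicate-free so that [j != i] removes one factor. *)
Lemma derivation_prod (I : eqType) (r : seq I) (F : I -> R) : uniq r ->
  D (\prod_(i <- r) F i) =
  \sum_(i <- r) D (F i) * \prod_(j <- r | j != i) F j.
Proof.
elim: r => [_|x r IH /= /andP[xr ur]]; first by rewrite !big_nil.
rewrite !big_cons eqxx /= DM IH // mulr_sumr; congr (_ * _ + _).
  rewrite big_seq [RHS]big_seq_cond; apply: eq_bigl => j.
  by case: (boolP (j \in r)) => //= jr; apply/esym; apply: contraNneq xr => <-.
apply: eq_big_seq => i ir; rewrite big_cons mulrCA.
by have -> : x != i by apply: contraNneq xr => ->.
Qed.

(** Jacobi's formula.  By the Leibniz rule [D (\det A)] is the sum over [i] of
the determinants of the matrices [B i] obtained by applying [D] to row [i]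
only; expand each along that row. *)
Lemma derivation_det n (A : 'M[R]_n) :
  D (\det A) = \sum_i \sum_j D (A i j) * cofactor A i j.
Proof.
have Dsum (I : Type) (r : seq I) (F : I -> R) :
    D (\sum_(i <- r) F i) = \sum_(i <- r) D (F i).
  exact: (big_morph D DD D0).
pose B i : 'M[R]_n := \matrix_(k, j) if k == i then D (A k j) else A k j.
transitivity (\sum_i \det (B i)).
  rewrite /determinant Dsum exchange_big; apply: eq_bigr => s _.
  have -> x : D ((-1) ^+ odd_perm s * x) = (-1) ^+ odd_perm s * D x.
    by case: (odd_perm s); rewrite ?expr0 ?expr1 ?mulN1r ?mul1r ?DN.
  rewrite derivation_prod ?index_enum_uniq // mulr_sumr.
  apply: eq_bigr => i _; congr (_ * _).
  rewrite [RHS](bigD1 i) //= mxE eqxx; congr (_ * _).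
  by apply: eq_bigr => j /negbTE ji; rewrite mxE ji.
apply: eq_bigr => i _; rewrite (expand_det_row _ i); apply: eq_bigr => j _.
rewrite mxE eqxx; congr (_ * (_ * \det _)).
by apply/matrixP => k l; rewrite !mxE eq_sym (negbTE (neq_lift _ _)).
Qed.
End Derivation.

(** * Logarithmic derivatives of formal power series *)

Section EulerOperator.
Variable F : fieldType.
Implicit Types f g L : fps F.

(** The derivation [z d/dz]; unlike [d/dz] it preserves degrees. *)
Definition euler f : fps F := Fps (fun n => n%:R * coefs f n).

Lemma eulerD : {morph euler : f g / f + g}.
Proof. by move=> f g; apply/fpsP => n; rewrite /= mulrDr. Qed.

Lemma eulerM f g : euler (f * g) = euler f * g + f * euler g.
Proof.
apply/fpsP => n; rewrite /= mulr_sumr -big_split /=; apply: eq_bigr => i _.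
rewrite -{1}(subnKC (ltnSE (ltn_ord i))) natrD mulrDl mulrA; congr (_ + _).
exact: mulrCA.
Qed.

Lemma coefs_sum (I : Type) (r : seq I) (P : pred I) (f : I -> fps F) n :
  coefs (\sum_(i <- r | P i) f i) n = \sum_(i <- r | P i) coefs (f i) n.
Proof. by apply: (big_morph (fun f => coefs f n)). Qed.

Lemma coefsMn f k n : coefs (f *+ k) n = coefs f n *+ k.
Proof. by elim: k => // k IH; rewrite !mulrS /= IH. Qed.

Lemma coefs1 n : coefs (1 : fps F) n = (n == 0%N)%:R.
Proof. by rewrite /=; case: (n == 0%N). Qed.

Lemma coefsMC f c n : coefs (f * fpsC c) n = coefs f n * c.
Proof.
rewrite /= big_ord_recr /= subnn eqxx big1 ?add0r // => i _.
by rewrite subn_eq0 leqNgt ltn_ord mulr0.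
Qed.

Lemma coefs_mulXn f k n :
  coefs (fpsX F ^+ k * f) n = if (k <= n)%N then coefs f (n - k) else 0.
Proof.
elim: k n => [|k IH] n; first by rewrite expr0 mul1r subn0.
rewrite exprS -mulrA; case: n => [|n]; first by rewrite /= big_ord1 mul0r.
have shift g : coefs (fpsX F * g) n.+1 = coefs g n.
  rewrite /= !big_ord_recl /= mul0r add0r mul1r subn1 /= big1 ?addr0 // => i _.
  by rewrite mul0r.
by rewrite shift IH.
Qed.

Lemma euler_mulXnC k c :
  euler (fpsX F ^+ k * fpsC c) = (fpsX F ^+ k * fpsC c) *+ k.
Proof.
apply/fpsP => n.
rewrite coefsMn -[LHS]/(n%:R * coefs _ n) -[RHS]mulr_natl !coefs_mulXn /=.
case: leqP => [kn|_]; last by rewrite !mulr0.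
case: eqP => [/eqP|_]; last by rewrite !mulr0.
by rewrite subn_eq0 => nk; have -> : n = k by apply/eqP; rewrite eqn_leq nk kn.
Qed.

Definition const_coef f := coefs f 0.

Fact const_coef_is_zmod_morphism : zmod_morphism const_coef.
Proof. by []. Qed.
HB.instance Definition _ := GRing.isZmodMorphism.Build (fps F) F const_coef
  const_coef_is_zmod_morphism.

Fact const_coef_is_monoid_morphism : monoid_morphism const_coef.
Proof. by split=> // f g; rewrite /const_coef /= big_ord1. Qed.
HB.instance Definition _ := GRing.isMonoidMorphism.Build (fps F) F const_coef
  const_coef_is_monoid_morphism.

(** [L] is the Euler logarithmic derivative [z f' / f]. *)
Definition is_logder f L := coefs f 0 = 1 /\ euler f = f * L.

Lemma logder1 : is_logder 1 0.
Proof.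
split; rewrite ?coefs1 //; apply/fpsP => n; rewrite mulr0 [LHS]/=.
by case: n => [|n] /=; rewrite ?mul0r ?mulr0.
Qed.

Lemma logderM f g L K :
  is_logder f L -> is_logder g K -> is_logder (f * g) (L + K).
Proof.
move=> [f0 fL] [g0 gK]; split; first by rewrite /= big_ord1 f0 g0 mulr1.
by rewrite eulerM fL gK mulrDr mulrAC mulrA.
Qed.

Lemma logder_prod (I : Type) (r : seq I) (P : pred I) (f L : I -> fps F) :
  (forall i, P i -> is_logder (f i) (L i)) ->
  is_logder (\prod_(i <- r | P i) f i) (\sum_(i <- r | P i) L i).
Proof.
move=> fL; apply: (big_ind2 is_logder) => //; first exact: logder1.
by move=> f1 L1 f2 L2; apply: logderM.
Qed.

Lemma logderX f L k : is_logder f L -> is_logder (f ^+ k) (L *+ k).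
Proof.
move=> fL; rewrite -[k]card_ord -prodr_const -sumr_const.
exact: logder_prod.
Qed.

Lemma logderV f L : is_logder f L -> is_logder (1 / f) (- L).
Proof.
move=> [f0 fL]; rewrite div1r.
have uf : f \is a GRing.unit by rewrite unfold_in /= /fps_unit f0 oner_eq0.
have e1 : euler 1 = 0 by have [_ ->] := logder1; rewrite mulr0.
split.
  by have := rmorphV const_coef uf; rewrite /= /const_coef f0 invr1.
apply: (mulrI uf); rewrite mulrA divrr // mul1r.
apply/eqP; rewrite -subr_eq0 opprK addrC; apply/eqP.
by rewrite -e1 -(divrr uf) eulerM fL [f * L]mulrC -mulrA divrr // mulr1.
Qed.

End EulerOperator.

(** [n f_n = \sum_(i < n) f_i L_(n - i)] determines the coefficients of [f]
recursively from [f_0 = 1]; characteristic zero allows the division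
by [n]. *)
Lemma eq_coefs_logder (F : numFieldType) (f g L K : fps F) m :
  is_logder f L -> is_logder g K ->
  (forall j, (j <= m)%N -> coefs L j = coefs K j) -> coefs f m = coefs g m.
Proof.
have lower (h H : fps F) n : is_logder h H ->
    n%:R * coefs h n = \sum_(i < n) coefs h i * coefs H (n - i)%N.
  move=> [h0 hH]; have H0 : coefs H 0 = 0.
    by have /fpsP/(_ 0%N) := hH; rewrite /= mul0r big_ord1 h0 mul1r.
  have /fpsP/(_ n) := hH; rewrite /= big_ord_recr /= => ->.
  by rewrite subnn H0 mulr0 addr0.
move=> fL gK; elim/ltn_ind: m => -[|m] IH LK.
  by case: fL gK => -> _ [-> _].
apply: (mulfI (_ : m.+1%:R != 0)); first by rewrite pnatr_eq0.
rewrite (lower _ _ _ fL) (lower _ _ _ gK); apply: eq_bigr => i _.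
rewrite LK ?leq_subr // IH // => j ji; apply: LK.
exact: leq_trans ji (ltnW (ltn_ord i)).
Qed.

(** * The logarithmic derivative of the determinant *)

Section LogDerivativeOfDeterminant.
Variables (n : nat) (T : 'M[rat]_n) (k : nat).
Hypothesis k0 : (0 < k)%N.

(** The series [\sum_(m > 0) z^(k m) T^m], written entrywise. *)
Definition geometric_mx : 'M[fps rat]_n := \matrix_(i, j)
  Fps (fun m => if (0 < m)%N && (k %| m)%N then (T ^+ (m %/ k)) i j else 0).

Let X := fpsX rat ^+ k.
Let CT := map_mx (@fpsC rat) T.

Lemma geometric_mxE : geometric_mx *m (1%:M - X *: CT) = X *: CT.
Proof.
(* The recurrence that defines the geometric series, read off degree by degree:
   [m - k] is replaced by [m] below. *)
suff E : geometric_mx = X *: (CT + geometric_mx *m CT).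
  by rewrite mulmxBr mulmx1 -scalemxAr {1}E scalerDr addrK.
apply/matrixP => i j; rewrite [LHS]mxE [RHS]mxE; apply/fpsP => m.
rewrite coefs_mulXn [LHS]/=.
have [km|mk] := leqP k m; last first.
  by case: m mk => //= m mk; rewrite gtnNdvd.
rewrite -{1 2 3}(subnK km) dvdn_addl ?dvdnn // divnDr ?dvdnn // divnn k0 addn1.
rewrite addn_gt0 k0 orbT /= {km}; move: (m - k)%N => {}m.
rewrite !mxE [coefs (_ + _) _]/= coefs_sum.
under eq_bigr => l _ do rewrite !mxE coefsMC /=.
case: m => [|m] /=.
  by rewrite dvdn0 div0n expr1 big1 ?addr0 // => l _; rewrite mul0r.
rewrite add0r; case: ifP => _; last by rewrite big1 // => l _; rewrite mul0r.
by rewrite exprSr mxE.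
Qed.

(** With [M = 1 - z^k T] and [S] the geometric series, [S *m M = z^k T] and
[euler M = - k z^k T].  Jacobi's formula then gives
[- k tr (S *m M *m \adj M) = - k (tr S) \det M], which avoids inverting
[M]. *)
Lemma det_series_logder :
  is_logder (det_series T k) (- (\tr geometric_mx *+ k)).
Proof.
rewrite /det_series -/X -/CT; split.
  have X0 : const_coef X = 0.
    by rewrite /X rmorphXn /= /const_coef /= expr0n eqn0Ngt k0.
  rewrite -[coefs _ _]/(const_coef _) -det_map_mx map_mxB map_mx1 map_mxZ /= X0.
  by rewrite scale0r subr0 det1.
set M := 1%:M - X *: CT.
rewrite (derivation_det (@eulerD _) (@eulerM _)).
have eM i j : euler (M i j) = - ((X *: CT) i j *+ k).
  have eulerC b : euler (b%:R : fps rat) = 0.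
    apply/fpsP => m; elim: b => [|b IH]; first exact: mulr0.
    by rewrite mulrS eulerD (proj2 (logder1 rat)) mulr0 add0r.
  have eulerN (g : fps rat) : euler (- g) = - euler g.
    by apply/fpsP => m /=; rewrite mulrN.
  by rewrite !mxE eulerD eulerC add0r eulerN euler_mulXnC.
under eq_bigr => i _ do under eq_bigr => j _ do rewrite eM mulNr mulrnAl.
transitivity (- (\tr ((X *: CT) *m \adj M) *+ k)).
  rewrite /mxtrace -sumrMnl -sumrN; apply: eq_bigr => i _.
  rewrite mxE -sumrMnl -sumrN; apply: eq_bigr => j _.
  by rewrite [(\adj M) _ _]mxE.
by rewrite -geometric_mxE -mulmxA mul_mx_adj mul_mx_scalar mxtraceZ mulrN mulrnAr.
Qed.

Lemma coefs_trace_geometric_mx m : coefs (\tr geometric_mx) m =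
  if (0 < m)%N && (k %| m)%N then \tr (T ^+ (m %/ k)) else 0.
Proof.
rewrite coefs_sum; under eq_bigr do rewrite mxE /=.
by case: ifP => // _; rewrite big1.
Qed.
End LogDerivativeOfDeterminant.

(** * The two infinite products *)

Section ProductFactor.
Variables (n1 n2 : nat) (T1 : 'M[rat]_n1) (T2 : 'M[rat]_n2).
Hypothesis hT2 : is_graph_matrix T2.

Definition factor_logder k : fps rat :=
  \tr (geometric_mx T1 k) *+ k *+ Num.truncn (cycle_count T2 k).

Lemma product_factor_logder k : (0 < k)%N ->
  is_logder (product_factor T1 T2 k) (factor_logder k).
Proof.
move=> k0; apply: logderX; rewrite -[X in is_logder _ X]opprK; apply: logderV.
exact: det_series_logder.
Qed.

Let mu d : rat := (moebius d)%:~R.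

(** The factor [k] contributes to degree [m] only if [k] divides [m], and then
by [k C(k, T2)] times the trace of [T1 ^+ (m %/ k)]; the index [k] of the
logarithmic derivative cancels the denominator of [C(k, T2)]. *)
Lemma coefs_sum_logder m n : (m <= n)%N ->
  coefs (\sum_(1 <= k < n.+1) factor_logder k) m =
  if (0 < m)%N then
    dconv mu (dconv (fun d => \tr (T1 ^+ d)) (fun d => \tr (T2 ^+ d))) m
  else 0.
Proof.
move=> mn; rewrite coefs_sum.
have termE k : (0 < k)%N -> coefs (factor_logder k) m =
    if (0 < m)%N && (k %| m)%N then
      dconv mu (fun d => \tr (T2 ^+ d)) k * \tr (T1 ^+ (m %/ k)) else 0.
  move=> k0; rewrite !coefsMn coefs_trace_geometric_mx.
  case: ifP => _; last by rewrite !mul0rn.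
  rewrite -mulr_natl truncnK ?cycle_count_nat // cycle_countE -[\tr _ *+ k]mulr_natl.
  by rewrite mulrACA mulVf ?mul1r // pnatr_eq0 -lt0n.
rewrite (eq_big_nat _ _ (fun k kn => termE k (proj1 (andP kn)))).
have [->|m0] := posnP m; first by rewrite big1.
rewrite -big_mkcond -big_filter (perm_big (divisors m)) /=.
  by rewrite -dconvCA // dconvC.
apply: uniq_perm; rewrite ?filter_uniq ?iota_uniq ?divisors_uniq // => d.
rewrite mem_filter mem_index_iota -dvdn_divisors // ltnS.
case: (boolP (d %| m)%N) => //= dm.
by rewrite (dvdn_gt0 m0 dm) (leq_trans (dvdn_leq m0 dm) mn).
Qed.

Lemma prod_factor_logder n :
  is_logder (\prod_(1 <= k < n.+1) product_factor T1 T2 k)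
            (\sum_(1 <= k < n.+1) factor_logder k).
Proof.
rewrite big_nat_cond [X in is_logder _ X]big_nat_cond.
by apply: logder_prod => k /andP[/andP[k1 _] _]; apply: product_factor_logder.
Qed.
End ProductFactor.

(** Taking [n = m] on one side shows that the partial products stabilise in
degree [m] from the [m]-th one on, with the same limit for both products. *)
Lemma coefs_prod_factor n1 n2 (T1 : 'M[rat]_n1) (T2 : 'M[rat]_n2) m n n' :
  is_graph_matrix T1 -> is_graph_matrix T2 -> (m <= n)%N -> (m <= n')%N ->
  coefs (\prod_(1 <= k < n.+1) product_factor T1 T2 k) m =
  coefs (\prod_(1 <= k < n'.+1) product_factor T2 T1 k) m.
Proof.
move=> hT1 hT2 mn mn'.
apply: (eq_coefs_logder (prod_factor_logder T1 T2 n) (prod_factor_logder T2 T1 n')).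
move=> j jm; rewrite !coefs_sum_logder ?(leq_trans jm) //; case: posnP => // j0.
by apply: eq_dconv_r => // d d0; apply: dconvC.
Qed.

Theorem theorem2p1 (n1 n2 : nat) (T1 : 'M[rat]_n1) (T2 : 'M[rat]_n2)
    (hT1 : is_graph_matrix T1) (hT2 : is_graph_matrix T2) :
  exists P : fps rat,
    is_infinite_product (product_factor T1 T2) P /\
    is_infinite_product (product_factor T2 T1) P.
Proof.
exists (Fps (fun m => coefs (\prod_(1 <= k < m.+1) product_factor T1 T2 k) m)).
split=> m; exists m => n mn /=; last exact/esym/coefs_prod_factor.
rewrite (coefs_prod_factor (n' := m) hT1 hT2 mn) //.
exact/esym/coefs_prod_factor.
Qed.
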